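(* Assume the following three conditions. (i) There exist positive absolute constants $\xi_1,\xi_2,\xi_3$ such that, for every sufficiently large $n$ and every $\theta\in\Theta_n$, $$P_\star^{(n)}\left[\exp(-\lambda\{\ell_n(\theta)-\ell_n^\star\})\right]\le \exp(-\xi_1\mathcal L_n(\theta)),\qquad P_\star^{(n)}\left[\exp(\lambda\xi_2\{\ell_n(\theta)-\ell_n^\star\})\right]\le \exp(\xi_3\mathcal L_n(\theta)).$$ (ii) There exists an absolute constant $\rho>0$ such that, with $\bar\rho=(1+\rho)/\rho$, for every sufficiently large $n$ and every $k\in[M_n]$ there are constants $R_{n,k}>0$ and $U_{n,k}>0$ with $$\log\mathcal N\left(R_{n,k},\Pi[\Psi]_{n,k},\mathcal D_{1+\rho}\right)\le U_{n,k},\qquad U_{n,k}+\rho R_{n,k}\le(2\bar\rho)^{-1}\check{\mathcal E}_n(k).$$ (iii) There exists an absolute constant $\xi_5>0$ such that, for every sufficiently large $n$ and every $k\in[M_n]$, there are a distribution $Q^*_{n,k}\in\mathcal Q_{n,k}$ and a hyperparameter $\psi^*_{n,k}\in\Psi_{n,k}$ with $$\log\left(\int\exp(\xi_3\mathcal L_n(\theta))\,dQ^*_{n,k}(\theta)\right)\le\xi_5\check{\mathcal E}_n(k),\quad \mathrm{KL}\left(Q^*_{n,k},\Pi_{n,k}(\cdot|\psi^*_{n,k})\right)\le\xi_5\check{\mathcal E}_n(k),\quad \Upsilon_{n,k}(\psi^*_{n,k})\le\xi_5\check{\mathcal E}_n(k).$$ Then there exist absolute constants $\check\tau_*>0$ and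 $C_4>0$ such that, for every sufficiently large $n$, $$P_\star^{(n)}\left(\check m_n\ge\check k_n^\dagger(\check\tau_* )+1\right)\ge1-\check\eta_n,\qquad \check\eta_n:=\check k_n^\dagger(\check\tau_* )\exp\left(-C_4\,\check{\mathcal E}_n(\check k_n^\dagger(\check\tau_* ))\right).$$
   Context: Setup. For each $n$, a sample $X^{(n)}$ with values in a measurable space $\mathcal X_n$ is drawn from the true distribution $P_\star^{(n)}$; $P_\star^{(n)}[\cdot]$ denotes expectation and $P_\star^{(n)}(\cdot)$ probability under it. $\mathcal P(\cdot)$ is the set of probability measures on a space; $[m]=\{1,\dots,m\}$; $a\wedge b=\min\{a,b\}$. The models are parameter spaces $\Theta_{n,1},\dots,\Theta_{n,M_n}$, each $\theta$ indexing a distribution $P_\theta^{(n)}\in\mathcal P(\mathcal X_n)$, and they are nested: for each $k<M_n$ there is an embedding $T:\Theta_{n,k}\to\Theta_{n,k+1}$ with $P^{(n)}_\theta=P^{(n)}_{T(\theta)}$ for all $\theta\in\Theta_{n,k}$. Put $\Theta_n=\bigcup_{k=1}^{M_n}\Theta_{n,k}$. A loss $\ell_n:\mathcal P(\mathcal X_n)\times\mathcal X_n\to[0,\infty)$ is given; write $\ell_n(\theta)=\ell_n(P_\theta^{(n)},X^{(n)})$ and $\ell_n^\star=\ell_n(P_\star^{(n)},X^{(n)})$. The excess risk is $\mathcal L_n(\theta)=P_\star^{(n)}[\ell_n(\theta)-\ell_n^\star]$. $\mathrm{KL}(P_1,P_2)=\int\log(dP_1/dP_2)\,dP_1$ if $P_1\ll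 P_2$, and $\infty$ otherwise. ''Absolute constant'' means a constant not depending on $n$ or $k$. Empirical variational Bayes. $\lambda>0$ is a fixed constant, and $\rho>0$, $\bar\rho=(1+\rho)/\rho$ are as in condition (ii). For each $k\in[M_n]$ there are a family of priors $\Pi[\Psi]_{n,k}=\{\Pi_{n,k}(\cdot|\psi):\psi\in\Psi_{n,k}\}$ on $\Theta_{n,k}$, a variational family $\mathcal Q_{n,k}\subset\mathcal P(\Theta_{n,k})$ and a function $\Upsilon_{n,k}:\Psi_{n,k}\to[0,\infty)$. Put $\mathrm{VFE}_{n,k}(Q,\psi)=\frac{\lambda}{\bar\rho}\int\ell_n(\theta)\,dQ(\theta)+\mathrm{KL}(Q,\Pi_{n,k}(\cdot|\psi))$. The pair $(\check Q_{n,k},\check\psi_{n,k})$ is a minimizer of $\mathrm{VFE}_{n,k}(Q,\psi)+\Upsilon_{n,k}(\psi)$ over $\mathcal Q_{n,k}\times\Psi_{n,k}$, and $\mathrm{mVFE\text{-}EB}_n(k)=\mathrm{VFE}_{n,k}(\check Q_{n,k},\check\psi_{n,k})$. Stopping index: $\check m_n=\inf\{k\in[M_n]\setminus\{1\}:\mathrm{mVFE\text{-}EB}_n(k-1)<\mathrm{mVFE\text{-}EB}_n(k)\}\wedge M_n$ (with $\inf\emptyset=\infty$). Excess risk of model $k$: $\check{\mathcal E}_n(k)=\inf_{\psi\in\Psi_{n,k}}\left[-\log\left(\int\exp(-\xi_1\mathcal L_n(\theta))\,d\Pi_{n,k}(\theta|\psi)\right)\right]$, with the same $\xi_1$ as in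 condition (i). Rényi-type covering number: for $\psi_0,\psi_1\in\Psi_{n,k}$ let $\mathcal D_{1+\rho}^{\Pi_{n,k}}(\psi_1,\psi_0)=\frac1\rho\log\int\left(\frac{d\Pi_{n,k}(\cdot|\psi_1)}{d\Pi_{n,k}(\cdot|\psi_0)}\right)^{\rho}d\Pi_{n,k}(\cdot|\psi_1)$ if $\Pi_{n,k}(\cdot|\psi_1)\ll\Pi_{n,k}(\cdot|\psi_0)$, and $\infty$ otherwise. $\mathcal N(R,\Pi[\Psi]_{n,k},\mathcal D_{1+\rho})$ is the minimal cardinality of a finite set $\Psi^\bullet\subset\Psi_{n,k}$ such that for every $\psi\in\Psi_{n,k}$ there is $\psi^\bullet\in\Psi^\bullet$ with $\mathcal D_{1+\rho}^{\Pi_{n,k}}(\psi,\psi^\bullet)\le R$. Near-optimal index: for $\tau>0$, $\check k_n^\dagger(\tau)=\inf\{k\in[M_n]:\check{\mathcal E}_n(k)\le(1+\tau)\check{\mathcal E}_n(k+1)\}\wedge M_n$ (so it equals $M_n$ if no $k<M_n$ satisfies the inequality).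
   Formalization: The event is stated as m̌_n ≥ (ǩ†_n+1)∧M_n, since m̌_n ≤ M_n makes the printed claim false when ǩ†_n = M_n (e.g. M_n=1 with growing excess risk); joint measurability of the loss and measurability of m̌_n are made explicit. *)

(* Defs.v *)
From HB Require Import structures.
From mathcomp Require Import all_boot all_order all_algebra.
From mathcomp Require Import all_classical all_reals all_analysis.

Set Implicit Arguments.
Unset Strict Implicit.
Unset Printing Implicit Defensive.

Import Order.TTheory GRing.Theory Num.Theory.

Local Open Scope classical_set_scope.
Local Open Scope ring_scope.
Local Open Scope ereal_scope.

Section divergences.
Context d (T : measurableType d) (R : realType).
Implicit Types P : probability T R.

(* dP1/dP2; only meaningful when P1 `<< P2 *)
Definition density P1 P2 : T -> \bar R :=
  Radon_Nikodym (charge_of_finite_measure P1) P2.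

Definition KL P1 P2 : \bar R :=
  if `[< P1 `<< P2 >] then \int[P1]_t lne (density P1 P2 t) else +oo.

(* Renyi divergence of order 1 + rho *)
Definition renyi (rho : R) P1 P2 : \bar R :=
  if `[< P1 `<< P2 >]
  then (rho^-1)%:E * lne (\int[P1]_t (density P1 P2 t `^ rho))
  else +oo.

End divergences.

Section empirical_variational_bayes.
Context (R : realType).

Definition rhobar (rho : R) : R := ((1 + rho) / rho)%R.

(* The loss is not assumed to be integrable: the excess risk is an extended
   real number, and the exponential moment bounds force it to be finite. *)
Definition excess_risk d (X : measurableType d) (Pstar : probability X R)
    (loss : probability X R -> X -> R) (P : probability X R) : \bar R :=
  'E_Pstar[fun x => (loss P x - loss Pstar x)%R].

Context dT (Theta : measurableType dT) (Psi : Type).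

(* l is the loss of each parameter on the observed sample *)
Definition VFE (lambda rho : R) (prior : Psi -> probability Theta R)
    (l : Theta -> R) (Q : probability Theta R) (psi : Psi) : \bar R :=
  (lambda / rhobar rho)%:E * \int[Q]_t (l t)%:E + KL Q (prior psi).

Definition model_excess_risk (xi1 : R) (prior : Psi -> probability Theta R)
    (L : Theta -> \bar R) : \bar R :=
  ereal_inf [set - lne (\int[prior psi]_t expeR (- (xi1%:E * L t)))
            | psi in [set: Psi]].

Definition renyi_cover (rho Rad : R) (prior : Psi -> probability Theta R)
    (S : set Psi) : Prop :=
  forall psi, exists2 psi0, S psi0 &
    renyi rho (prior psi) (prior psi0) <= Rad%:E.

(* +oo when there is no finite cover *)
Definition covering_number (rho Rad : R)
    (prior : Psi -> probability Theta R) : \bar R :=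
  ereal_inf [set (m%:R)%:E | m in
    [set m | exists2 S : set Psi, (S #= `I_m)%card & renyi_cover rho Rad prior S]].

End empirical_variational_bayes.

(* Both indices are written as a minimum over the admissible k, with M as the
   default value, i.e. as (inf of the admissible set) `min` M. *)
Definition stopping_index (R : realType) (M : nat) (v : nat -> \bar R) : nat :=
  \big[minn/M]_(2 <= k < M.+1 | v k.-1 < v k) k.

(* k = M is left out of the range because E M.+1 is not defined in the model
   sequence; as an admissible value it would only contribute M. *)
Definition near_optimal_index (R : realType) (M : nat) (E : nat -> \bar R)
    (tau : R) : nat :=
  \big[minn/M]_(1 <= k < M | E k <= (1 + tau)%:E * E k.+1) k.

(* Main.v *)
Require Import Defs.
From HB Require Import structures.
From mathcomp Require Import all_boot all_order all_algebra.
From mathcomp Require Import all_classical all_reals all_analysis.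
From mathcomp Require Import measurable_realfun ring lra.

(* Write b = (1 + rho) / rho. The Donsker-Varadhan bound and Hoelder's inequality
   with exponents b and 1 + rho give, for a point psi0 of the Renyi cover at
   distance at most r from psi and every Q,
     VFE(Q, psi) >= (lambda / b) lstar
                    - (log int exp(- lambda (l - lstar)) dPrior(psi0) + r) / b,
   so Markov's inequality at the finitely many points of the cover yields
   mVFE(k) >= (lambda / b) lstar + E(k) / (4 b) off an event of probability
   exp(- E(k) / 8). The pair (Qstar, psistar) as a competitor and Jensen's
   inequality yield mVFE(k + 1) <= (lambda / b) lstar + E(k) / (8 b) when
   E(k) > (1 + tau) E(k + 1) with tau large, off an event of probability
   exp(- xi2 E(k) / 16). Since k < kdagger forces that inequality, and then
   E(k) >= E(kdagger), a union bound over k < kdagger concludes; halving the rate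
   in the exponent absorbs the factor 2. *)

Set Implicit Arguments.
Unset Strict Implicit.
Unset Printing Implicit Defensive.

Import Order.TTheory GRing.Theory Num.Theory.

Local Open Scope classical_set_scope.
Local Open Scope ring_scope.
Local Open Scope ereal_scope.

(** * Monotonicity and strict positivity of integrals *)

Section integral_monotonicity.
Context d (T : measurableType d) (R : realType).
Variable mu : {measure set T -> \bar R}.

(* The integral of a nonnegative function is a supremum over simple functions,
   and the convention [+oo - +oo = -oo] is compatible with monotonicity. *)
Lemma integral_mono (f g : T -> \bar R) : (forall t, f t <= g t) ->
  \int[mu]_t f t <= \int[mu]_t g t.
Proof.
have mono0 (u v : T -> \bar R) : (forall t, 0 <= u t) ->
    (forall t, u t <= v t) -> \int[mu]_t u t <= \int[mu]_t v t.
  move=> u0 uv; have v0 t : 0 <= v t by exact: le_trans (u0 t) (uv t).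
  rewrite !ge0_integralTE//; apply: ereal_sup_le => _ [h /= hu <-].
  by exists h => // t; exact: le_trans (hu t) (uv t).
move=> fg; rewrite integralE [leRHS]integralE; apply: leeB.
  apply: mono0 => t; first exact: funepos_ge0.
  by apply: (@funepos_le _ _ setT) => //; rewrite inE.
apply: mono0 => t; first exact: funeneg_ge0.
by apply: (@funeneg_le _ _ setT) => //; rewrite inE.
Qed.

End integral_monotonicity.

(** A zero integral would make [f] vanish almost everywhere; as [f] vanishes nowhere, the
    exceptional null set would be the whole space, of probability 1. *)
Lemma integral_gt0 d (T : measurableType d) (R : realType)
    (P : probability T R) (f : T -> \bar R) :
  measurable_fun [set: T] f -> (forall t, 0 < f t) -> 0 < \int[P]_t f t.
Proof.
move=> mf f0; rewrite lt_neqAle integral_ge0 ?andbT; last first.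
  by move=> t _; exact: ltW.
apply/eqP => /esym int0.
have : \int[P]_t `|f t| = 0.
  by rewrite -[RHS]int0; apply: eq_integral => t _; rewrite gee0_abs// ltW.
move=> /(ae_eq_integral_abs P measurableT mf) -[N [mN N0 fN]].
have NT : N = setT.
  by apply/seteqP; split => // t _; apply: fN => /= /(_ I) ft; have := f0 t;
    rewrite ft ltxx.
have : P N = 1 by rewrite NT; exact: probability_setT.
by move=> /(etrans (esym N0))/esym/eqP; rewrite onee_eq0.
Qed.

(** * Divergences as integrals of a real-valued log-density *)

Section log_density.
Context d (T : measurableType d) (R : realType).
Implicit Types (P Q : probability T R).

(* real-valued; equal to the junk value 0 where the density is not positive *)
Definition log_density P Q (t : T) : R := ln (fine (density P Q t)).

Lemma measurable_density P Q : P `<< Q ->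
  measurable_fun [set: T] (density P Q : T -> \bar R).
Proof.
by move=> PQ; apply: measurable_int; exact: Radon_Nikodym_integrable.
Qed.

Lemma density_fin_num P Q t : P `<< Q -> density P Q t \is a fin_num.
Proof. by move=> PQ; exact: Radon_Nikodym_fin_num. Qed.

Lemma measurable_log_density P Q : P `<< Q ->
  measurable_fun [set: T] (log_density P Q).
Proof.
move=> PQ; apply: measurableT_comp => //.
by apply: measurableT_comp => //; exact: measurable_density.
Qed.

(** The [P]-mass of the set where the density is at most 0 is the [Q]-integral of the density over
    it, hence at most 0. *)
Lemma density_gt0 P Q : P `<< Q -> {ae P, forall t, 0 < density P Q t}.
Proof.
move=> PQ; have mp := measurable_density PQ.
have mA : measurable [set t | density P Q t <= 0].
  by rewrite -[X in measurable X]setTI; exact: emeasurable_fun_infty_c.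
exists [set t | density P Q t <= 0]; split => //.
  apply/eqP; rewrite eq_le measure_ge0 andbT.
  have -> : P [set t | density P Q t <= 0] =
      \int[Q]_(t in [set t | density P Q t <= 0]) density P Q t.
    rewrite -(@Radon_Nikodym_integral _ _ _ (charge_of_finite_measure P) Q)//.
  rewrite integral_mkcond; set A := [set t | _].
  rewrite -(@integral0 _ _ _ Q setT); apply: integral_mono => t.
  by rewrite patchE; case: ifPn => //; rewrite inE.
by move=> t /= /negP; rewrite -leNgt.
Qed.

Lemma ge0_integral_density P Q (f : T -> \bar R) : P `<< Q ->
  measurable_fun [set: T] f -> (forall t, 0 <= f t) ->
  \int[P]_t f t = \int[Q]_t (f t * density P Q t).
Proof.
move=> PQ mf f0.
rewrite -(@Radon_Nikodym_SigmaFinite.change_of_variables _ _ _ P Q)//.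
have mRN : measurable_fun [set: T] (Radon_Nikodym_SigmaFinite.f P Q).
  exact: measurable_int (Radon_Nikodym_SigmaFinite.f_integrable _).
apply: ae_eq_integral => //.
- exact: emeasurable_funM.
- by apply: emeasurable_funM => //; exact: measurable_density.
- by apply: ae_eqe_mul2l; exact: ae_eq_Radon_Nikodym_SigmaFinite.
Qed.

(** The product of [expR (- log_density P Q t)] and the density is 1 where the density is positive
    and at most 0 elsewhere. Only an inequality holds, since [Q] may charge the set where the
    density vanishes. *)
Lemma integral_div_density P Q (f : T -> \bar R) : P `<< Q ->
  measurable_fun [set: T] f -> (forall t, 0 <= f t) ->
  \int[P]_t (f t * (expR (- log_density P Q t))%:E) <= \int[Q]_t f t.
Proof.
move=> PQ mf f0.
rewrite (ge0_integral_density PQ); last 2 first.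
- apply: emeasurable_funM => //; apply/measurable_EFinP.
  apply: measurableT_comp => //; apply: measurable_funN.
  exact: measurable_log_density.
- by move=> t; rewrite mule_ge0// lee_fin expR_ge0.
apply: integral_mono => t; rewrite -muleA -[leRHS]mule1 lee_wpmul2l//.
rewrite /log_density -(fineK (density_fin_num t PQ)) -EFinM lee_fin /=.
have [p0|p0] := ltP 0%R (fine (density P Q t)).
  by rewrite expRN lnK ?mulVf// ?gt_eqF.
by rewrite (le_trans (mulr_ge0_le0 _ p0)) ?expR_ge0.
Qed.

(** The two integrands can differ only where the density is not positive, which is a [P]-null
    set. *)
Lemma KLE P Q : P `<< Q -> KL P Q = \int[P]_t (log_density P Q t)%:E.
Proof.
move=> PQ; rewrite /KL asboolT//.
have mp : measurable_fun [set: T] (fun t => fine (density P Q t)).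
  by apply: measurableT_comp => //; exact: measurable_density.
apply: ae_eq_integral => //.
- rewrite (_ : (fun t => _) = fun t =>
      if (fine (density P Q t) <= 0)%R then -oo else (log_density P Q t)%:E).
    apply: measurable_fun_ifT => //; first exact: measurable_fun_ler.
    by apply/measurable_EFinP; exact: measurable_log_density.
  by apply/funext => t; rewrite -(fineK (density_fin_num t PQ)).
- by apply/measurable_EFinP; exact: measurable_log_density.
- apply: filterS (density_gt0 PQ) => t p0 _; rewrite /log_density.
  rewrite -[in LHS](fineK (density_fin_num t PQ)) lne_EFin//.
  by rewrite -lte_fin fineK// density_fin_num.
Qed.

Lemma renyiE (rho : R) P Q : P `<< Q -> renyi rho P Q =
  (rho^-1)%:E * lne (\int[P]_t (expR (rho * log_density P Q t))%:E).
Proof.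
move=> PQ; rewrite /renyi asboolT//; congr (_ * lne _).
apply: ae_eq_integral => //.
- by apply: (measurableT_comp (measurable_poweR _)); exact: measurable_density.
- apply/measurable_EFinP; apply: measurableT_comp => //.
  by apply: measurable_funM => //; exact: measurable_log_density.
- apply: filterS (density_gt0 PQ) => t p0 _; rewrite /log_density.
  rewrite -[in LHS](fineK (density_fin_num t PQ)) poweR_EFin /powR gt_eqF//.
  by rewrite -lte_fin fineK// density_fin_num.
Qed.

End log_density.

(** * Donsker-Varadhan, Jensen and Hoelder inequalities *)

Section variational_inequalities.
Context d (T : measurableType d) (R : realType).
Implicit Types (P Q : probability T R) (h : T -> R).

Lemma integral_cst_probability P (r : R) : \int[P]_t r%:E = r%:E.
Proof.
by rewrite integral_cst// [X in _ * X]probability_setT mule1.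
Qed.

Lemma integrable_ge0 P h : measurable_fun [set: T] h ->
  (forall t, 0 <= h t)%R -> \int[P]_t (h t)%:E < +oo ->
  P.-integrable [set: T] (EFin \o h).
Proof.
move=> mh h0 hoo; apply/integrableP; split; first exact/measurable_EFinP.
by under eq_integral => t _ do rewrite /= ger0_norm//.
Qed.

(** The function [w], which is [expR (s - h)] divided by the density, has [P]-mean at most 1.
    Integrating the tangent bound [1 + s - h - w <= log_density P Q] gives the claim; finiteness of
    the mean of [h] lets it be moved across. *)
Let DonskerVaradhan_integrable P Q h (s : R) :
  measurable_fun [set: T] h -> (forall t, 0 <= h t)%R ->
  \int[P]_t (h t)%:E < +oo ->
  \int[Q]_t (expR (- h t))%:E <= (expR (- s))%:E ->
  s%:E <= \int[P]_t (h t)%:E + KL P Q.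
Proof.
move=> mh h0 hoo hs.
have [PQ|nPQ] := pselect (P `<< Q); last first.
  by rewrite /KL asboolF// addey ?leey// gt_eqF// (lt_le_trans ltNy0)//
    integral_ge0// => t _; rewrite lee_fin.
pose w t : R := (expR s * (expR (- h t) * expR (- log_density P Q t)))%R.
have ml := measurable_log_density PQ.
have mw : measurable_fun [set: T] w.
  apply: measurable_funM => //; apply: measurable_funM.
    by apply: measurableT_comp => //; exact: measurable_funN.
  by apply: measurableT_comp => //; exact: measurable_funN.
have w1 : \int[P]_t (w t)%:E <= 1.
  under eq_integral => t _ do rewrite /w EFinM EFinM.
  rewrite ge0_integralZl//; last first.
    apply: emeasurable_funM; apply/measurable_EFinP; apply: measurableT_comp => //;
      exact: measurable_funN.
  have -> : 1 = (expR s)%:E * (expR (- s))%:E :> \bar R.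
    by rewrite -EFinM -expRD subrr expR0.
  rewrite lee_wpmul2l ?lee_fin ?expR_ge0//; apply: le_trans hs.
  apply: (integral_div_density PQ) => [|t]; last by rewrite lee_fin expR_ge0.
  by apply/measurable_EFinP; apply: measurableT_comp => //; exact: measurable_funN.
have iw : P.-integrable [set: T] (EFin \o w).
  apply: integrable_ge0 => // [t|]; last by rewrite (le_lt_trans w1)// ltry.
  by rewrite /w !mulr_ge0// expR_ge0.
have ih := integrable_ge0 mh h0 hoo.
rewrite KLE// -leeBlDl; last exact: integrable_fin_num.
have -> : \int[P]_t (h t)%:E = \int[P]_t (EFin \o h) t by [].
apply: le_trans (_ : \int[P]_t ((1 + s)%:E - (h t)%:E - (w t)%:E) <= _).
  rewrite integralB//; last first.
    by apply: integrableB => //; exact: finite_measure_integrable_cst.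
  rewrite integralB//; last exact: finite_measure_integrable_cst.
  rewrite integral_cst_probability.
  have := w1; have := integrable_fin_num measurableT iw.
  have := integrable_fin_num measurableT ih.
  rewrite /comp; case: (\int[_]_ _ (h _)%:E) => // a _.
  case: (\int[_]_ _ (w _)%:E) => // b _.
  by rewrite -!EFinB !lee_fin; lra.
apply: integral_mono => t; rewrite -!EFinB lee_fin.
have := expR_ge1Dx (s + (- h t + - log_density P Q t)).
by rewrite expRD expRD -/(w t); lra.
Qed.

Lemma KL_ge0 P Q : 0 <= KL P Q.
Proof.
have := @DonskerVaradhan_integrable P Q (cst 0%R) 0%R (measurable_cst _).
rewrite [in X in X -> _]/= integral0 add0e; apply=> //.
by rewrite oppr0 expR0 integral_cst_probability.
Qed.

(* one half of the Donsker-Varadhan variational formula *)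
Lemma DonskerVaradhan_le P Q h (s : R) :
  measurable_fun [set: T] h -> (forall t, 0 <= h t)%R ->
  \int[Q]_t (expR (- h t))%:E <= (expR (- s))%:E ->
  s%:E <= \int[P]_t (h t)%:E + KL P Q.
Proof.
move=> mh h0 hs; have [hoo|] := ltP (\int[P]_t (h t)%:E) +oo.
  exact: DonskerVaradhan_integrable.
rewrite leye_eq => /eqP ->; rewrite addye ?leey//.
by rewrite gt_eqF// (lt_le_trans ltNy0)// KL_ge0.
Qed.

(** Jensen's inequality through the tangent line of [expR] at 0: [h] lies below an affine function
    of the normalised exponential [w], whose mean is at most 1. *)
Lemma integral_le_ln_expR P h (c l0 s : R) : (0 < c)%R ->
  measurable_fun [set: T] h -> (forall t, 0 <= h t)%R ->
  \int[P]_t (expR (c * (h t - l0)))%:E <= (expR s)%:E ->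
  \int[P]_t (h t)%:E <= (l0 + s / c)%:E.
Proof.
move=> c0 mh h0 hs.
pose w t : R := (expR (- s) * expR (c * (h t - l0)))%R.
have mw : measurable_fun [set: T] w.
  apply: measurable_funM => //; apply: measurableT_comp => //.
  by apply: measurable_funM => //; exact: measurable_funB.
have w1 : \int[P]_t (w t)%:E <= 1.
  under eq_integral => t _ do rewrite /w EFinM.
  rewrite ge0_integralZl//; last first.
    apply/measurable_EFinP; apply: measurableT_comp => //.
    by apply: measurable_funM => //; exact: measurable_funB.
  have -> : 1 = (expR (- s))%:E * (expR s)%:E :> \bar R.
    by rewrite -EFinM -expRD addNr expR0.
  by rewrite lee_wpmul2l ?lee_fin ?expR_ge0.
have iw : P.-integrable [set: T] (EFin \o w).
  apply: integrable_ge0 => // [t|]; last by rewrite (le_lt_trans w1)// ltry.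
  by rewrite /w !mulr_ge0// expR_ge0.
apply: le_trans (_ : _ <=
    \int[P]_t ((l0 + (s - 1) / c)%:E + (c^-1)%:E * (w t)%:E)) _.
  apply: integral_mono => t; rewrite -EFinM -EFinD lee_fin.
  rewrite -(ler_pM2l c0) !mulrDr mulrA mulfV ?gt_eqF// mul1r mulrCA mulfV ?gt_eqF//.
  have := expR_ge1Dx (- s + c * (h t - l0)); rewrite expRD -/(w t); lra.
rewrite integralD//; [|exact: finite_measure_integrable_cst|exact: integrableZl].
rewrite integral_cst_probability integralZl//.
have := w1; have := integrable_fin_num measurableT iw.
rewrite /comp; case: (\int[_]_ _ (w _)%:E) => // b _.
rewrite -EFinM -EFinD !lee_fin => b1.
have : (c^-1 * b <= c^-1 * 1)%R by rewrite ler_pM2l ?invr_gt0.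
by rewrite mulrBl mul1r mulr1; lra.
Qed.

(* Hoelder's inequality with the conjugate exponents [rhobar rho] and [1 + rho];
   normalising both factors reduces it to the convexity of [expR]. *)
Lemma integral_renyi_le (rho : R) P Q h (u r : R) : (0 < rho)%R ->
  measurable_fun [set: T] h ->
  \int[Q]_t (expR (- (rhobar rho * h t)))%:E <= (expR u)%:E ->
  renyi rho P Q <= r%:E ->
  \int[P]_t (expR (- h t))%:E <= (expR ((u + r) / rhobar rho))%:E.
Proof.
move=> rho0 mh hu Pr; set b := rhobar rho in hu *.
have [PQ|nPQ] := pselect (P `<< Q); last first.
  by move: Pr; rewrite /renyi asboolF.
have ml := measurable_log_density PQ.
pose lp := log_density P Q.
have b0 : (0 < b)%R by rewrite divr_gt0// addr_gt0.
have rho1 : (0 < 1 + rho)%R by rewrite addr_gt0.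
(* The weights [b^-1] and [(1 + rho)^-1] sum to 1; the exponential factors normalise the two
   integrals bounded in [int1] and [int2]. *)
pose a1 : R := (b^-1 * expR (- u))%R.
pose a2 : R := ((1 + rho)^-1 * expR (- (rho * r)))%R.
have a10 : (0 <= a1)%R by rewrite mulr_ge0 ?expR_ge0 ?invr_ge0 ?ltW.
have a20 : (0 <= a2)%R by rewrite mulr_ge0 ?expR_ge0 ?invr_ge0 ?ltW.
have mf1 : measurable_fun [set: T] (fun t => (expR (- (b * h t)))%:E).
  apply/measurable_EFinP; apply: measurableT_comp => //; apply: measurable_funN.
  exact: measurable_funM.
have mf2 : measurable_fun [set: T] (fun t => (expR (- lp t))%:E).
  by apply/measurable_EFinP; apply: measurableT_comp => //; exact: measurable_funN.
have mf3 : measurable_fun [set: T] (fun t => (expR (rho * lp t))%:E).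
  by apply/measurable_EFinP; apply: measurableT_comp => //; exact: measurable_funM.
have int1 : \int[P]_t ((expR (- (b * h t)))%:E * (expR (- lp t))%:E) <= (expR u)%:E.
  by apply: le_trans hu; exact: (integral_div_density PQ).
have int2 : \int[P]_t (expR (rho * lp t))%:E <= (expR (rho * r))%:E.
  move: Pr; rewrite renyiE// lee_pdivrMl// -EFinM -lee_expeR lneK//.
  by rewrite in_itv/= leey andbT integral_ge0// => t _; rewrite lee_fin expR_ge0.
pose C : R := expR ((u + r) / b).
apply: le_trans (_ : _ <= \int[P]_t (C%:E * (a1%:E * ((expR (- (b * h t)))%:E *
    (expR (- lp t))%:E) + a2%:E * (expR (rho * lp t))%:E))) _.
  apply: integral_mono => t; rewrite -!EFinM lee_fin.
  set x : R := (- h t - (u + r) / b)%R.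
  have -> : (- h t)%R = ((u + r) / b + x)%R by rewrite /x; lra.
  rewrite expRD ler_pM2l ?expR_gt0// /a1 /a2 -!mulrA -!expRD.
  set y1 : R := (- u + _)%R; set y2 : R := (- (rho * r) + _)%R.
  (* Tangent line of [expR] at [x]. Since [x] is the weighted mean of [y1] and [y2] (this is [e0]),
     the linear terms cancel in the weighted sum. *)
  have conv (y : R) : (expR x * (1 + (y - x)) <= expR y)%R.
    have := expR_ge1Dx (y - x).
    by rewrite -(ler_pM2l (expR_gt0 x)) -expRD [in leRHS]addrC subrK.
  have eb : b = ((1 + rho) / rho)%R by [].
  have e0 : (b^-1 * (y1 - x) + (1 + rho)^-1 * (y2 - x) = 0)%R.
    by rewrite /y1 /y2 /x eb /lp; field; rewrite !gt_eqF.
  have e1 : (b^-1 + (1 + rho)^-1 = 1)%R by rewrite eb; field; rewrite !gt_eqF.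
  apply: le_trans (_ : _ <= b^-1 * (expR x * (1 + (y1 - x))) +
      (1 + rho)^-1 * (expR x * (1 + (y2 - x))))%R _; last first.
    by apply: lerD; rewrite ler_wpM2l// invr_ge0 ltW.
  rewrite [leRHS](_ : _ = expR x * ((b^-1 + (1 + rho)^-1) +
    (b^-1 * (y1 - x) + (1 + rho)^-1 * (y2 - x))))%R; last by ring.
  by rewrite e0 e1 addr0 mulr1.
have nn1 t : 0 <= (expR (- (b * h t)))%:E * (expR (- lp t))%:E.
  by rewrite mule_ge0 ?lee_fin ?expR_ge0.
have nn2 t : 0 <= (expR (rho * lp t))%:E by rewrite lee_fin expR_ge0.
have mf12 := emeasurable_funM mf1 mf2.
have mg1 : measurable_fun [set: T] (fun t => a1%:E *
    ((expR (- (b * h t)))%:E * (expR (- lp t))%:E)).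
  exact: emeasurable_funM.
have mg2 : measurable_fun [set: T] (fun t => a2%:E * (expR (rho * lp t))%:E).
  exact: emeasurable_funM.
have ng1 t : 0 <= a1%:E * ((expR (- (b * h t)))%:E * (expR (- lp t))%:E).
  by rewrite mule_ge0.
have ng2 t : 0 <= a2%:E * (expR (rho * lp t))%:E by rewrite mule_ge0.
rewrite ge0_integralZl ?lee_fin ?expR_ge0//; last 2 first.
- exact: emeasurable_funD.
- by move=> t _; rewrite adde_ge0.
rewrite -[leRHS]mule1 lee_wpmul2l ?lee_fin ?expR_ge0//.
rewrite ge0_integralD// ge0_integralZl// ge0_integralZl//.
apply: le_trans (leeD (lee_wpmul2l _ int1) (lee_wpmul2l _ int2)) _ => //.
rewrite -!EFinM -EFinD lee_fin /a1 /a2 -!mulrA -!expRD !addNr !expR0 !mulr1.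
have -> : b = ((1 + rho) / rho)%R by [].
by rewrite le_eqVlt; apply/orP; left; apply/eqP; field; rewrite !gt_eqF.
Qed.

End variational_inequalities.

(** * High-probability bounds on the variational free energy *)

Section free_energy_events.
Context dX (X : measurableType dX) dT (T : measurableType dT) (R : realType).
Variable Pstar : probability X R.
Context (Psi : Type).
Variable prior : Psi -> probability T R.
Variables lambda rho : R.
Hypotheses (lambda0 : (0 < lambda)%R) (rho0 : (0 < rho)%R).

Let b := rhobar rho.

Let b0 : (0 < b)%R. Proof. by rewrite divr_gt0// addr_gt0. Qed.

Lemma VFEE (l : T -> R) (Q : probability T R) psi :
  measurable_fun [set: T] l -> (forall t, 0 <= l t)%R ->
  VFE lambda rho prior l Q psi =
    \int[Q]_t (lambda / b * l t)%:E + KL Q (prior psi).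
Proof.
move=> ml l0; rewrite /VFE; congr (_ + _).
under [RHS]eq_integral do rewrite EFinM.
have lb0 : (0 <= lambda / b)%R by rewrite divr_ge0// ltW.
rewrite ge0_integralZl//; first exact/measurable_EFinP.
by move=> t _; rewrite lee_fin.
Qed.

(** Hoelder's inequality moves the exponential moment from [prior psi0] to [prior psi], at the price
    of dividing [lambda] by [b]; Donsker-Varadhan then covers every [Q]. *)
Lemma VFE_ge (l : T -> R) (Q : probability T R) psi psi0 (l0 u r : R) :
  measurable_fun [set: T] l -> (forall t, 0 <= l t)%R ->
  \int[prior psi0]_t (expR (- lambda * (l t - l0)))%:E <= (expR u)%:E ->
  renyi rho (prior psi) (prior psi0) <= r%:E ->
  (lambda / b * l0 - (u + r) / b)%:E <= VFE lambda rho prior l Q psi.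
Proof.
move=> ml lge0 hu hr; rewrite VFEE//.
pose h t : R := (lambda / b * (l t - l0))%R.
have mh : measurable_fun [set: T] h.
  by apply: measurable_funM => //; exact: measurable_funB.
have : \int[prior psi]_t (expR (- h t))%:E <= (expR ((u + r) / b))%:E.
  apply: (integral_renyi_le rho0 mh _ hr).
  rewrite (_ : (fun t => _) = fun t => (expR (- lambda * (l t - l0)))%:E)//.
  apply/funext => t; congr (expR _)%:E; rewrite /h -/b.
  by field; rewrite gt_eqF.
(* [h] may be negative, so Donsker-Varadhan is applied to [lambda / b * l] and the shift by [l0] is
   pulled out as a constant factor. *)
move=> hh; apply: DonskerVaradhan_le => [|t|].
- exact: measurable_funM.
- by rewrite mulr_ge0// divr_ge0// ltW.
- have -> : (fun t => (expR (- (lambda / b * l t)))%:E) = fun t =>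
      (expR (- (lambda / b * l0)))%:E * (expR (- h t))%:E.
    apply/funext => t; rewrite -EFinM -expRD; congr (expR _)%:E.
    by rewrite /h; ring.
  rewrite ge0_integralZl ?lee_fin ?expR_ge0//; last first.
    by apply/measurable_EFinP; apply: measurableT_comp => //; exact: measurable_funN.
  apply: le_trans (lee_wpmul2l _ hh) _; first by rewrite lee_fin expR_ge0.
  by rewrite -EFinM -expRD lee_fin ler_expR; lra.
Qed.

Lemma markov_expR (f : X -> \bar R) (u v : R) :
  measurable_fun [set: X] f -> (forall x, 0 <= f x) ->
  \int[Pstar]_x f x <= (expR v)%:E ->
  Pstar [set x | (expR u)%:E < f x] <= (expR (v - u))%:E.
Proof.
move=> mf f0 fv; set A := [set x | _].
have mA : measurable A.
  by rewrite -[A]setTI; exact: emeasurable_fun_o_infty.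
rewrite expRD expRN EFinM muleC lee_pdivlMl ?expR_gt0//.
apply: le_trans fv.
have -> : Pstar A = \int[Pstar]_x (\1_A x)%:E by rewrite integral_indic// setIT.
rewrite -ge0_integralZl ?lee_fin ?expR_ge0//; last first.
- by apply/measurable_EFinP.
apply: integral_mono => x; rewrite indicE; case: (boolP (x \in A)) => xA.
  by rewrite mule1; move: xA; rewrite inE => /ltW.
by rewrite mule0.
Qed.

Variables (l : T -> X -> R) (ls : X -> R).
Hypotheses (ml : measurable_fun [set: (T * X)%type] (fun tx => l tx.1 tx.2))
  (l0 : forall t x, (0 <= l t x)%R) (mls : measurable_fun [set: X] ls).

Let mlx x : measurable_fun [set: T] (l ^~ x).
Proof. exact: (measurableT_comp ml (pair2_measurable x)). Qed.

Let mlexp (c : R) : measurable_fun [set: (T * X)%type]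
  (fun tx => (expR (c * (l tx.1 tx.2 - ls tx.2)))%:E).
Proof.
apply/measurable_EFinP; apply: measurableT_comp => //.
apply: measurable_funM => //; apply: measurable_funB => //.
exact: measurableT_comp.
Qed.

Let Tonelli (Q : probability T R) (c : R) :
  \int[Pstar]_x \int[Q]_t (expR (c * (l t x - ls x)))%:E =
  \int[Q]_t 'E_Pstar[fun x => expR (c * (l t x - ls x))].
Proof.
have := fubini_tonelli (m1 := Q) (m2 := Pstar) _ (mlexp c).
by rewrite unlock => <-.
Qed.

Let mexp (Q : probability T R) (c : R) : measurable_fun [set: X]
  (fun x => \int[Q]_t (expR (c * (l t x - ls x)))%:E).
Proof.
apply: (measurable_fun_fubini_tonelli_G _ (mlexp c)) => -[t x].
by rewrite lee_fin expR_ge0.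
Qed.

Lemma measurable_expectation_expR (c : R) : measurable_fun [set: T]
  (fun t => 'E_Pstar[fun x => expR (c * (l t x - ls x))]).
Proof.
rewrite unlock.
apply: (measurable_fun_fubini_tonelli_F (m2 := Pstar) _ (mlexp c)) => -[t x].
by rewrite lee_fin expR_ge0.
Qed.

Lemma expectation_expR_gt0 (c : R) (t : T) :
  0 < 'E_Pstar[fun x => expR (c * (l t x - ls x))].
Proof.
rewrite unlock; apply: integral_gt0 => [|x]; last by rewrite lte_fin expR_gt0.
exact: (measurableT_comp (mlexp c) (pair1_measurable t)).
Qed.

(** The gap between [U] and [V] puts the infimum strictly below [expR V], so an actual cover is that
    small; [psi0] fills the values of [g] from [m] on. *)
Lemma covering_enum (r U V : R) (psi0 : Psi) :
  lne (covering_number rho r prior) <= U%:E -> (U < V)%R ->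
  exists m (g : nat -> Psi), (m%:R <= expR V :> R)%R /\
    forall psi, exists2 i, (i < m)%N & renyi rho (prior psi) (prior (g i)) <= r%:E.
Proof.
move=> hU UV; have : covering_number rho r prior < (expR V)%:E.
  rewrite -[ltRHS]/(expeR V%:E) -lte_lne ?in_itv/= ?leey ?andbT ?lee_fin ?expR_ge0//.
    by rewrite (le_lt_trans hU)// leNgt expR_gt0/= lte_fin expRK.
  by apply/ereal_infP => _ [m _ <-]; rewrite lee_fin.
move=> /ereal_inf_lt[_ [m [S Sm cov] <-]]; rewrite lte_fin => mV.
have /card_set_bijP[f [fS finj fsurj]] := Sm.
have /choice[g gP] (i : nat) : exists psi, (i < m)%N -> S psi /\ f psi = i.
  have [im|im] := ltnP i m; last by exists psi0.
  by have [psi Spsi <-] := fsurj i im; exists psi.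
exists m, g; split; first exact: ltW.
move=> psi; have [p0 Sp0 rp0] := cov psi; exists (f p0); first exact: fS.
have [Sg fg] := gP _ (fS _ Sp0).
by rewrite (finj (g (f p0)) p0) ?inE.
Qed.

(** The union bound runs over the finite cover only, yet one event serves all [Q] and [psi] at once,
    as a data-dependent minimizer requires. *)
Lemma VFE_lower_event (e r U : R) (psi0 : Psi) : (0 < e)%R -> (0 < r)%R -> (0 < U)%R ->
  (forall psi, \int[prior psi]_t 'E_Pstar[fun x => expR (- lambda * (l t x - ls x))]
     <= (expR (- e))%:E) ->
  lne (covering_number rho r prior) <= U%:E ->
  (U + rho * r <= (2 * b)^-1 * e)%R ->
  exists2 G, measurable G & Pstar (~` G) <= (expR (- (e / 8)))%:E /\
    forall x, G x -> forall Q psi,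
      (lambda / b * ls x + e / (4 * b))%:E <= VFE lambda rho prior (l ^~ x) Q psi.
Proof.
move=> e0 r0 U0 he hU hUr.
(* Multiplying the hypothesis by [b] suffices, because [b * (U + rho * r)] exceeds [U + r] by
   [U / rho + rho * r]. *)
have Ur : (U + r <= e / 2)%R.
  have rho1 : (0 < 1 + rho)%R by rewrite addr_gt0.
  have -> : (U + r = rho^-1 * (rho * (U + r)))%R by rewrite mulKf ?gt_eqF.
  rewrite ler_pdivrMl//; have := hUr.
  rewrite (_ : (2 * b)^-1 * e = (rho * (e / 2)) / (1 + rho))%R; last first.
    by rewrite /b /rhobar; field; rewrite !gt_eqF.
  rewrite ler_pdivlMr//; apply: le_trans; rewrite -subr_ge0.
  rewrite [leRHS](_ : _ = U + rho * (rho * r))%R; last by ring.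
  by rewrite addr_ge0 ?mulr_ge0// ltW.
have UV : (U < U + e / 16)%R by rewrite ltrDl divr_gt0.
have [m [g [mV cov]]] := covering_enum psi0 hU UV.
pose A i x := \int[prior (g i)]_t (expR (- lambda * (l t x - ls x)))%:E.
(* Each [B i] has probability at most [expR (- (U + 3 * e / 16))]; at most [expR (U + e / 16)] of
   them leave [expR (- (e / 8))]. Off them, [u + r <= - 5 * e / 16], below the [- e / 4] that is
   needed. *)
pose u : R := (- e + (U + (e / 16) * 3))%R.
pose B i := [set x | (expR u)%:E < A i x].
have mB i : measurable (B i).
  by rewrite -[B i]setTI; apply: emeasurable_fun_o_infty => //; exact: mexp.
have PB i : Pstar (B i) <= (expR (- e - u))%:E.
  apply: markov_expR => [|x|]; first exact: mexp.
    by apply: integral_ge0 => t _; rewrite lee_fin expR_ge0.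
  by rewrite Tonelli.
exists (~` \big[setU/set0]_(i < m) B i).
  by apply: measurableC; exact: bigsetU_measurable.
split.
  rewrite setCK; have := @Boole_inequality _ _ _ Pstar B m (fun i _ => mB i).
  move=> /le_trans; apply.
  apply: (@le_trans _ _ (\sum_(i < m) (expR (- e - u))%:E)).
    by apply: lee_sum => i _; exact: PB.
  rewrite sumEFin sumr_const card_ord -(mulr_natl _ m) lee_fin.
  apply: le_trans (ler_wpM2r _ mV) _; first exact: expR_ge0.
  by rewrite -expRD ler_expR /u; lra.
move=> x /= Gx Q psi; have [i im hr] := cov psi.
have : ~ B i x.
  by move=> Bi; apply: Gx; rewrite -bigcup_mkord; exists i.
move=> /negP; rewrite -leNgt => Ai.
apply: le_trans (VFE_ge Q (mlx x) (l0 ^~ x) Ai hr).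
rewrite lee_fin lerD2l -mulNr invfM mulrA ler_pM2r ?invr_gt0// /u; lra.
Qed.

(** [Q] and [psi] are fixed before the sample is seen, so a single Markov bound followed by Jensen's
    inequality suffices; [s] trades probability against sharpness. *)
Lemma VFE_upper_event (xi e s : R) (Q : probability T R) psi :
  (0 < xi)%R ->
  \int[Q]_t 'E_Pstar[fun x => expR (lambda * xi * (l t x - ls x))] <= (expR e)%:E ->
  exists2 G, measurable G & Pstar (~` G) <= (expR (- s))%:E /\
    forall x, G x -> VFE lambda rho prior (l ^~ x) Q psi <=
      (lambda / b * ls x + (e + s) / (xi * b))%:E + KL Q (prior psi).
Proof.
move=> xi0 he.
pose A x := \int[Q]_t (expR (lambda * xi * (l t x - ls x)))%:E.
exists (~` [set x | (expR (e + s))%:E < A x]).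
  apply: measurableC; rewrite -[X in measurable X]setTI.
  by apply: emeasurable_fun_o_infty => //; exact: mexp.
split.
  rewrite setCK (_ : (- s = e - (e + s))%R); last by lra.
  apply: markov_expR => [|x|]; first exact: mexp.
    by apply: integral_ge0 => t _; rewrite lee_fin expR_ge0.
  by rewrite Tonelli.
move=> x /= /negP; rewrite -leNgt => Ax; apply: leeD => //.
have c0 : (0 < lambda * xi)%R by rewrite mulr_gt0.
have := integral_le_ln_expR c0 (mlx x) (l0 ^~ x) Ax.
move=> /(lee_wpmul2l (_ : 0 <= (lambda / b)%:E)) => h.
apply: le_trans (h _) _; first by rewrite lee_fin divr_ge0// ltW.
rewrite -EFinM lee_fin mulrDr lerD2l le_eqVlt; apply/orP; left; apply/eqP.
by field; rewrite !gt_eqF.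
Qed.

End free_energy_events.

(** Serves both indices: it extracts the failure of near-optimality below [kdagger], and it reduces
    a lower bound on [mcheck] to a check at each admissible index. *)
Lemma leq_bigminn (r : seq nat) (Q : pred nat) (M m : nat) :
  (m <= \big[minn/M]_(k <- r | Q k) k)%N =
  (m <= M)%N && all (fun k => Q k ==> (m <= k)%N) r.
Proof.
elim: r => [|a r IH]; first by rewrite big_nil andbT.
rewrite big_cons /=; case: (Q a) => //=.
by rewrite leq_min IH andbCA.
Qed.

(** * Finiteness of the model excess risk *)

Section model_excess_risk.
Context (R : realType) d (T : measurableType d) (Psi : Type).
Variables (prior : Psi -> probability T R) (xi1 : R) (L f : T -> \bar R).
Hypotheses (mf : measurable_fun [set: T] f) (f0 : forall t, 0 < f t)
  (fL : forall t, f t <= expeR (- (xi1%:E * L t))).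

(** Here [f] stands for the exponential moment of the loss difference. Its positivity keeps the
    integrals away from 0, so their [- lne] is below [+oo] and the infimum is real. *)
Lemma model_excess_risk_bound (psi0 : Psi) :
  0 < model_excess_risk xi1 prior L ->
  exists e : R, [/\ model_excess_risk xi1 prior L = e%:E, (0 < e)%R &
    forall psi, \int[prior psi]_t f t <= (expR (- e))%:E].
Proof.
set E := model_excess_risk _ _ _ => E0.
have le_E psi : E <= - lne (\int[prior psi]_t expeR (- (xi1%:E * L t))).
  by apply: ereal_inf_lbound; exists psi.
have int0 psi : 0 < \int[prior psi]_t expeR (- (xi1%:E * L t)).
  exact: lt_le_trans (integral_gt0 _ mf f0) (integral_mono _ fL).
have Eoo : E < +oo.
  apply: le_lt_trans (le_E psi0) _.
  move: (int0 psi0); case: (\int[_]_ _ _) => //= r r0.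
  by rewrite leNgt -lte_fin r0 ltry.
have Efin : E \is a fin_num by rewrite fin_real// Eoo andbT (lt_trans _ E0) ?ltNy0.
exists (fine E); rewrite -lte_fin fineK//; split=> // psi.
apply: le_trans (integral_mono _ fL) _.
move: (le_E psi); rewrite leeNr -{1}(fineK Efin) -EFinN -lee_expeR lneK//.
by rewrite in_itv/= leey andbT ltW.
Qed.

End model_excess_risk.

(** * Union bound over the models below the near-optimal index *)

Theorem theorem4p1 (R : realType)
    (* sample spaces, true distributions, nested models, loss *)
    (dX : nat -> measure_display) (X : forall n, measurableType (dX n))
    (Pstar : forall n, probability (X n) R)
    (M : nat -> nat)
    (dT : nat -> nat -> measure_display)
    (Theta : forall n k, measurableType (dT n k))
    (P : forall n k, Theta n k -> probability (X n) R)
    (loss : forall n, probability (X n) R -> X n -> R)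
    (* priors, variational families, penalties, fitted pairs *)
    (Psi : nat -> nat -> Type)
    (prior : forall n k, Psi n k -> probability (Theta n k) R)
    (QQ : forall n k, set (probability (Theta n k) R))
    (Upsilon : forall n k, Psi n k -> R)
    (Qcheck : forall n k, X n -> probability (Theta n k) R)
    (psicheck : forall n k, X n -> Psi n k)
    (lambda rho xi1 xi2 xi3 : R) :
  let L n k (t : Theta n k) : \bar R :=
    excess_risk (Pstar n) (loss n) (P n k t) in
  let vfe n k (x : X n) (Q : probability (Theta n k) R) (psi : Psi n k) :=
    VFE lambda rho (prior n k) (fun t => loss n (P n k t) x) Q psi in
  let mVFE n (x : X n) (k : nat) : \bar R :=
    vfe n k x (Qcheck n k x) (psicheck n k x) in
  let mcheck n (x : X n) : nat := stopping_index (M n) (mVFE n x) in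
  let E n k : \bar R := model_excess_risk xi1 (prior n k) (L n k) in
  let kdagger n (tau : R) : nat := near_optimal_index (M n) (E n) tau in
  (forall n, (1 <= M n)%N) ->
  (forall n k, (1 <= k < M n)%N ->
     exists T : Theta n k -> Theta n k.+1,
       injective T /\ forall t, P n k t = P n k.+1 (T t)) ->
  (forall n (Q : probability (X n) R) x, (0 <= loss n Q x)%R) ->
  (forall n, measurable_fun [set: X n] (loss n (Pstar n))) ->
  (forall n k, (1 <= k <= M n)%N ->
     measurable_fun [set: (Theta n k * X n)%type]
       (fun tx => loss n (P n k tx.1) tx.2)) ->
  (forall n k (psi : Psi n k), (1 <= k <= M n)%N ->
     (0 <= Upsilon n k psi)%R) ->
  (forall n k (x : X n), (1 <= k <= M n)%N ->
     QQ n k (Qcheck n k x) /\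
     forall Q psi, QQ n k Q ->
       vfe n k x (Qcheck n k x) (psicheck n k x)
         + (Upsilon n k (psicheck n k x))%:E
       <= vfe n k x Q psi + (Upsilon n k psi)%:E) ->
  (forall n, measurable_fun [set: X n] (mcheck n)) ->
  (0 < lambda)%R -> (0 < rho)%R ->
  (0 < xi1)%R -> (0 < xi2)%R -> (0 < xi3)%R ->
  (* (i) *)
  (\forall n \near \oo, forall k (t : Theta n k), (1 <= k <= M n)%N ->
     'E_(Pstar n)[fun x =>
         expR (- lambda * (loss n (P n k t) x - loss n (Pstar n) x))]
       <= expeR (- (xi1%:E * L n k t)) /\
     'E_(Pstar n)[fun x =>
         expR (lambda * xi2 * (loss n (P n k t) x - loss n (Pstar n) x))]
       <= expeR (xi3%:E * L n k t)) ->
  (* (ii) *)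
  (\forall n \near \oo, forall k, (1 <= k <= M n)%N ->
     exists Rnk Unk : R, [/\ (0 < Rnk)%R, (0 < Unk)%R,
       lne (covering_number rho Rnk (prior n k)) <= Unk%:E &
       (Unk + rho * Rnk)%:E <= ((2 * rhobar rho)^-1)%:E * E n k]) ->
  (* (iii) *)
  (exists2 xi5 : R, (0 < xi5)%R &
   \forall n \near \oo, forall k, (1 <= k <= M n)%N ->
     exists (Qstar : probability (Theta n k) R) (psistar : Psi n k),
       [/\ QQ n k Qstar,
           lne (\int[Qstar]_t expeR (xi3%:E * L n k t)) <= xi5%:E * E n k,
           KL Qstar (prior n k psistar) <= xi5%:E * E n k &
           (Upsilon n k psistar)%:E <= xi5%:E * E n k]) ->
  exists tau C4 : R, [/\ (0 < tau)%R, (0 < C4)%R &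
    (* mcheck n x <= M n always, hence the truncation of kdagger + 1 at M n;
       it is inactive as soon as kdagger < M n *)
    \forall n \near \oo,
      1 - ((kdagger n tau)%:R)%:E * expeR (- (C4%:E * E n (kdagger n tau)))
      <= Pstar n [set x | (minn (kdagger n tau).+1 (M n) <= mcheck n x)%N]].
Proof.
move=> L vfe mVFE mcheck E kdagger M1 _ loss0 mls ml Ups0 Qmin mmcheck lambda0 rho0
  xi10 xi20 xi30 H1 H2 [xi5 xi50 H3].
set b := rhobar rho.
have b0 : (0 < b)%R by rewrite divr_gt0// addr_gt0.
(* [tau / 16] is the total coefficient of [e j.+1] in [b] times the upper bound for model [j.+1]:
   [xi5 / xi2] from the loss, and [b * xi5] each from [KL] and the penalty. *)
pose tau : R := (16 * (xi5 / xi2 + 2 * b * xi5))%R.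
have tau0 : (0 < tau)%R.
  have x1 : (0 < xi5 / xi2)%R by rewrite divr_gt0.
  have x2 : (0 < b * xi5)%R by rewrite mulr_gt0.
  by rewrite /tau; lra.
(* The smaller of the rates of the lower and the upper event. *)
pose c : R := (Num.min 8^-1 (xi2 / 16))%R.
have c0 : (0 < c)%R by rewrite lt_min invr_gt0 ltr0n divr_gt0.
exists tau, (c / 2)%R; split => //; first by rewrite divr_gt0.
apply: filterS3 H1 H2 H3 => n H1 H2 H3.
set k := kdagger n tau.
(* Reading [k <= k] through the minimum that defines [k] shows that no [j < k] satisfies the
   near-optimality inequality. *)
have /esym/andP[kM /allP kall] : true =
    (k <= M n)%N && all (fun j => (E n j <= (1 + tau)%:E * E n j.+1) ==> (k <= j)%N)
      (index_iota 1 (M n)).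
  by rewrite -leq_bigminn leqnn.
have k1 : (1 <= k)%N.
  rewrite leq_bigminn M1/=; apply/allP => j; rewrite mem_index_iota => /andP[j1 _].
  by rewrite j1 implybT.
have Efin j : (1 <= j <= M n)%N -> exists e : R, [/\ E n j = e%:E, (0 < e)%R &
    forall psi, \int[prior n j psi]_t 'E_(Pstar n)[fun x =>
       expR (- lambda * (loss n (P n j t) x - loss n (Pstar n) x))] <=
       (expR (- e))%:E].
  move=> jM; have [_ [psi0 _]] := H3 j jM.
  apply: model_excess_risk_bound psi0 _.
  - exact: (measurable_expectation_expR _ (ml n j jM) (mls n)).
  - exact: (expectation_expR_gt0 _ (ml n j jM) (mls n)).
  - by move=> t; have [] := H1 j t jM.
  (* Condition (ii) forces [E n j] to be positive, because [U + rho * r] is. *)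
  have [r [U [r0 U0 _ UrE]]] := H2 j jM.
  rewrite ltNge; apply/negP => E0.
  have : (U + rho * r)%:E <= 0.
    by apply: le_trans UrE _; rewrite mule_ge0_le0// lee_fin invr_ge0 mulr_ge0// ltW.
  by apply/negP; rewrite -ltNge lte_fin addr_gt0// mulr_gt0.
pose e j : R := fine (E n j).
have eP j : (1 <= j <= M n)%N -> [/\ E n j = (e j)%:E, (0 < e j)%R &
    forall psi, \int[prior n j psi]_t 'E_(Pstar n)[fun x =>
       expR (- lambda * (loss n (P n j t) x - loss n (Pstar n) x))] <=
       (expR (- e j))%:E].
  by move=> /Efin[e' [Ee' e'0 he']]; rewrite /e Ee'.
have e_step j : (1 <= j < k)%N -> ((1 + tau) * e j.+1 < e j)%R.
  move=> /andP[j1 jk]; have jM := leq_trans jk kM.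
  have := kall j; rewrite mem_index_iota j1 jM => /(_ isT).
  have jM1 : (1 <= j <= M n)%N by rewrite j1 ltnW.
  have [-> _ _] := eP j jM1; have [-> _ _] := eP j.+1 jM.
  rewrite -EFinM lee_fin => /implyP h; rewrite ltNge; apply/negP => /h.
  by rewrite leqNgt jk.
have e_le j : (1 <= j <= k)%N -> (e k <= e j)%R.
  move=> /andP[j1 jk]; rewrite -(subKn jk).
  have := leq_subr j k; have : (k - j < k)%N by rewrite ltn_subrL j1.
  (* Induction on the distance below [k]; each step down from [k] can only increase [e], by
     [e_step]. *)
  elim: (k - j)%N => [|i IH] ik _; first by rewrite subn0.
  apply: le_trans (IH (ltnW ik) (ltnW (ltnW ik))) _.
  have ki : (1 <= k - i.+1 < k)%N by rewrite subn_gt0 ik ltn_subrL k1.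
  have := e_step _ ki; rewrite subnSK 1?ltnW//.
  have kiM : (1 <= k - i <= M n)%N.
    by rewrite subn_gt0 (ltnW ik) (leq_trans (leq_subr _ _)).
  have [_ e0 _] := eP _ kiM.
  move=> /ltW; apply: le_trans; rewrite ler_peMl//; first exact: ltW.
  by rewrite lerDl ltW.
have k1M : (1 <= k <= M n)%N by rewrite k1.
have [Ek ek0 _] := eP k k1M.
(* Bad samples are controlled by measurable events because [mVFE] itself need not
   be measurable. *)
have good_event j : (1 <= j < k)%N -> exists2 G, measurable G &
    Pstar n (~` G) <= (2 * expR (- (c * e k)))%:E /\
    forall x, G x -> mVFE n x j.+1 <= mVFE n x j.
  move=> jk; have [j1 jk'] := andP jk; have jM := leq_trans jk' kM.
  have jM1 : (1 <= j <= M n)%N by rewrite j1 ltnW.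
  have jM2 : (1 <= j.+1 <= M n)%N by rewrite jM.
  have [Ej ej0 hej] := eP j jM1; have [Ej1 ej10 _] := eP j.+1 jM2.
  have ekj : (e k <= e j)%R by rewrite e_le// j1 ltnW.
  have [_ [psi0 _]] := H3 j jM1.
  have [r [U [r0 U0 hU UrE]]] := H2 j jM1.
  have [Gl mGl [PGl lower]] : exists2 G, measurable G &
      Pstar n (~` G) <= (expR (- (e j / 8)))%:E /\ forall x, G x -> forall Q psi,
        (lambda / b * loss n (Pstar n) x + e j / (4 * b))%:E <= vfe n j x Q psi.
    apply: (VFE_lower_event lambda0 rho0 (ml n j jM1) _ (mls n) psi0 ej0 r0 U0 hej hU).
      by move=> t x; exact: loss0.
    by rewrite -lee_fin EFinM -Ej.
  have [Qs [psis [QQs hQs KLs Upss]]] := H3 j.+1 jM2.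
  have int_le : \int[Qs]_t 'E_(Pstar n)[fun x => expR (lambda * xi2 *
        (loss n (P n j.+1 t) x - loss n (Pstar n) x))] <= (expR (xi5 * e j.+1))%:E.
    apply: le_trans (integral_mono _ (fun t => (H1 j.+1 t jM2).2)) _.
    move: hQs; rewrite -/(E n j.+1) Ej1 -EFinM -lee_expeR lneK//.
    by rewrite in_itv/= leey andbT integral_ge0// => t _; exact: expeR_ge0.
  (* With [s = xi2 * e j / 16], the deviation costs only [e j / (16 * b)] in the bound. *)
  have [Gu mGu [PGu upper]] : exists2 G, measurable G &
      Pstar n (~` G) <= (expR (- (xi2 * e j / 16)))%:E /\ forall x, G x ->
        vfe n j.+1 x Qs psis <= (lambda / b * loss n (Pstar n) x +
          (xi5 * e j.+1 + xi2 * e j / 16) / (xi2 * b))%:E + KL Qs (prior n j.+1 psis).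
    apply: (VFE_upper_event (prior n j.+1) lambda0 rho0 (ml n j.+1 jM2) _ (mls n)
      _ psis xi20 int_le).
    by move=> t x; exact: loss0.
  exists (Gl `&` Gu); first exact: measurableI.
  split.
    rewrite setCI; apply: le_trans (measureU2 _ _ _) _; [exact: measurableC..|].
    rewrite (_ : 2 * _ = expR (- (c * e k)) + expR (- (c * e k)))%R; last by ring.
    rewrite EFinD; apply: leeD.
      apply: (le_trans PGl); rewrite lee_fin ler_expR lerN2 mulrC.
      by apply: ler_pM => //; [exact: ltW|exact: ltW|rewrite ge_min lexx].
    apply: (le_trans PGu); rewrite lee_fin ler_expR lerN2 mulrAC.
    by apply: ler_pM => //; [exact: ltW|exact: ltW|rewrite ge_min lexx orbT].
  move=> x [/lower lowx /upper upx].
  apply: le_trans (lowx _ _).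
  (* The fitted pair minimizes the penalised energy, whereas [mVFE] omits the penalty: the fitted
     penalty is dropped by nonnegativity, and the one at [psis] is at most [xi5 * e j.+1]. *)
  have [_ /(_ Qs psis QQs) opt] := Qmin n j.+1 x jM2.
  have := Ups0 n j.+1 (psicheck n j.+1 x) jM2.
  rewrite -lee_fin => Ups.
  apply: le_trans (_ : _ <= mVFE n x j.+1 + (Upsilon n j.+1 (psicheck n j.+1 x))%:E) _.
    exact: leeDl.
  apply: (le_trans opt).
  move: KLs Upss; rewrite -/(E n j.+1) Ej1 -EFinM => KLs Upss.
  apply: le_trans (leeD (le_trans upx (leeD (lexx _) KLs)) Upss) _.
  rewrite -!EFinD lee_fin -!addrA lerD2l.
  have := e_step j jk; rewrite /tau => /ltW est.
  rewrite -(ler_pM2l b0).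
  rewrite [leRHS](_ : _ = e j / 4)%R; last by field; rewrite gt_eqF.
  rewrite [leLHS](_ : _ = (16 * (xi5 / xi2 + 2 * b * xi5)) * e j.+1 / 16 + e j / 16)%R;
    last by field; rewrite !gt_eqF.
  lra.
(* Index [i] stands for model [i.+1], so that [i < k.-1] covers the models 1 to [k.-1]; [setT] is a
   filler beyond. *)
have /choice[G GP] (i : nat) : exists G, measurable G /\ ((i < k.-1)%N ->
    Pstar n (~` G) <= (2 * expR (- (c * e k)))%:E /\
    forall x, G x -> mVFE n x i.+2 <= mVFE n x i.+1).
  have [ik|ik] := ltnP i k.-1; last by exists setT.
  have [|G mG GP] := good_event i.+1; first by rewrite /= -ltn_predRL.
  by exists G.
pose B := \big[setU/set0]_(i < k.-1) ~` G i.
have mB : measurable B.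
  by apply: bigsetU_measurable => i _; apply: measurableC; exact: (GP i).1.
have PB : Pstar n B <= ((k.-1)%:R * (2 * expR (- (c * e k))))%:E.
  have := @Boole_inequality _ _ _ (Pstar n) (fun i => ~` G i) k.-1
    (fun i _ => measurableC (GP i).1).
  move=> /le_trans; apply.
  apply: (@le_trans _ _ (\sum_(i < k.-1) (2 * expR (- (c * e k)))%:E)).
    by apply: lee_sum => i _; exact: ((GP i).2 _).1.
  by rewrite sumEFin sumr_const card_ord (mulr_natl _ k.-1).
(* Off [B] the sequence [mVFE] does not increase up to index [k], so no [m <= k] can stop it; the
   truncation matches the default [M n] of the stopping index. *)
have BS : ~` B `<=` [set x | (minn k.+1 (M n) <= mcheck n x)%N].
  move=> x Bx /=; rewrite leq_bigminn geq_minr/=; apply/allP => m.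
  rewrite mem_index_iota => /andP[m2 mM]; apply/implyP => vlt.
  rewrite leqNgt; apply/negP; rewrite leq_min ltnS => /andP[mk _].
  case: m m2 mM vlt mk => [//|[//|i]] _ _ vlt ik.
  have ik' : (i < k.-1)%N by rewrite ltn_predRL.
  move: vlt; rewrite ltNge => /negP; apply; apply: ((GP i).2 ik').2.
  apply: contrapT => Gx; apply: Bx.
  by rewrite /B -(bigcup_mkord _ (fun i => ~` G i)); exists i.
have mS : measurable [set x | (minn k.+1 (M n) <= mcheck n x)%N].
  rewrite -[X in measurable X]setTI.
  exact: (mmcheck n measurableT [set m | (minn k.+1 (M n) <= m)%N]).
rewrite Ek; pose y : R := expR (- (c / 2 * e k)).
have -> : k%:R%:E * expeR (- ((c / 2)%:E * (e k)%:E)) = (k%:R * y)%:E by [].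
have y0 : (0 < y)%R by exact: expR_gt0.
(* If [k * y >= 1] the claimed lower bound is at most 0. Otherwise, for [k >= 2],
   [2 * y <= k * y < 1], so [2 * (y * y) <= y]; for [k = 1] the union is empty. *)
have [ky|ky] := leP 1%R (k%:R * y)%R.
  by apply: (@le_trans _ _ 0); rewrite ?measure_ge0// -EFinB lee_fin subr_le0.
apply: (@le_trans _ _ (Pstar n (~` B))); last first.
  by apply: le_measure; rewrite ?inE//; exact: measurableC.
rewrite probability_setC//; apply: leeB => //.
apply: (le_trans PB); rewrite lee_fin.
have -> : expR (- (c * e k)) = (y * y)%R.
  by rewrite -expRD; congr expR; lra.
have [->|k2] := eqVneq k 1%N; first by rewrite mul0r mul1r ltW.
have kge2 : (2 <= k%:R :> R)%R by rewrite ler_nat ltn_neqAle eq_sym k2.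
have kN : (k.-1%:R <= k%:R :> R)%R by rewrite ler_nat leq_pred.
apply: (@le_trans _ _ (k.-1%:R * y)%R); last by rewrite ler_pM2r.
rewrite ler_wpM2l//; nra.
Qed.
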